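(* If a given integro-differential equation $$H(t,y(t),y'(t))+\int_{t_0}^{t}G(s,y(s),y'(s))\,ds=\mathrm{const}$$ is the Euler--Lagrange equation of a variational problem $$\mathcal{I}(y)=\int_{t_0}^{t_1}L(t,y(t),y'(t))\,dt,$$ then its equation of variation $$\partial_2H[u]_{\mathbb{R}}(t)\,u(t)+\partial_3H[u]_{\mathbb{R}}(t)\,u'(t)+\int_{t_0}^{t}\Big(\partial_2G[u]_{\mathbb{R}}(s)\,u(s)+\partial_3G[u]_{\mathbb{R}}(s)\,u'(s)\Big)ds=0$$ must be self-adjoint, in the sense that it has the form $$p(t)u'(t)+\int_{t_0}^{t}q(s)u(s)\,ds=\mathrm{const}$$ with $p,q$ continuous and $p(t)\ne0$ for all $t$.
   Context: This is the case of the time scale $\mathbb{T}=\mathbb{R}$, where rd-continuity is continuity, with $y\in C^2([t_0,t_1];\mathbb{R})$. Notation: $\partial_i$ is the partial derivative with respect to the $i$-th argument; $[y]_{\mathbb{R}}(t)=(t,y(t),y'(t))$, so $F[y]_{\mathbb{R}}(t)=F(t,y(t),y'(t))$; ''const'' means some real constant independent of $t$. Standing assumptions (part of the definition of the equation of variation): $\partial_3H\neq0$, and for $F\in\{G,H\}$ the functions $t\mapsto\partial_2F[y]_{\mathbb{R}}(t)$, $t\mapsto\partial_3F[y]_{\mathbb{R}}(t)$ are continuous along every curve $y$. In the equation of variation, the coefficients $\partial_iH[u]_{\mathbb{R}}$, $\partial_iG[u]_{\mathbb{R}}$ are regarded as functions of $t$ along the curve $u$. Being the Euler--Lagrange equation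 of $\mathcal{I}$, with $L\in C^2$, means that the given equation is the integral-form Euler--Lagrange equation $\partial_3L[y]_{\mathbb{R}}(t)+\int_{t_0}^t-\partial_2L[y]_{\mathbb{R}}(s)\,ds=\mathrm{const}$, i.e. $H=\partial_3L$ and $G=-\partial_2L$.
   Formalization: It is additionally assumed that the coefficient ∂₃G[u](t) is continuously differentiable on [t₀,t₁]; for L merely C² the claim, read as an identity of linear expressions with p, q independent of the unknown function, can fail, and this condition is necessary. *)

(* Defs.v *)
From Stdlib Require Import Reals.
From Coquelicot Require Import Coquelicot.
Open Scope R_scope.

Definition cc (a b : R) : R -> Prop := fun t => a <= t <= b.

(* Derivatives on a closed interval are one-sided at its end points ([D_in] takes
   the difference quotient inside the interval only).  They are passed as
   companion functions, which are determined on [cc a b] as soon as a < b. *)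
Definition C1_curve (a b : R) (f f' : R -> R) : Prop :=
  (forall t, cc a b t -> D_in f f' (cc a b) t) /\ continuous_on (cc a b) f'.

Definition C2_curve (a b : R) (f f' : R -> R) : Prop :=
  C1_curve a b f f' /\ exists f'' : R -> R, C1_curve a b f' f''.

Definition pd2 (F : R -> R -> R -> R) (t y v : R) : R :=
  Derive (fun z => F t z v) y.

Definition pd3 (F : R -> R -> R -> R) (t y v : R) : R :=
  Derive (fun z => F t y z) v.

(* F[y](t) = F(t, y(t), y'(t)) *)
Definition along (F : R -> R -> R -> R) (y y' : R -> R) (t : R) : R :=
  F t (y t) (y' t).

(* Regularity of F on the closed slab [a,b] x R x R. *)
Definition slab_continuous (a b : R) (F : R -> R -> R -> R) : Prop :=
  continuous_on (fun x : R * R * R => cc a b (fst (fst x)))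
                (fun x : R * R * R => F (fst (fst x)) (snd (fst x)) (snd x)).

Definition is_pd1 (a b : R) (F F1 : R -> R -> R -> R) : Prop :=
  forall t y v, cc a b t ->
    D_in (fun s => F s y v) (fun s => F1 s y v) (cc a b) t.

Definition ex_pd23 (a b : R) (F : R -> R -> R -> R) : Prop :=
  forall t y v, cc a b t ->
    ex_derive (fun z => F t z v) y /\ ex_derive (fun z => F t y z) v.

Definition C1_slab (a b : R) (F : R -> R -> R -> R) : Prop :=
  (exists F1, is_pd1 a b F F1 /\ slab_continuous a b F1) /\
  ex_pd23 a b F /\ slab_continuous a b (pd2 F) /\ slab_continuous a b (pd3 F).

Definition C2_slab (a b : R) (F : R -> R -> R -> R) : Prop :=
  (exists F1, is_pd1 a b F F1 /\ C1_slab a b F1) /\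
  ex_pd23 a b F /\ C1_slab a b (pd2 F) /\ C1_slab a b (pd3 F).

(* The integro-differential equation
     H(t, y(t), y'(t)) + int_{t0}^t G(s, y(s), y'(s)) ds = const
   is given by the pair (H, G); it is the integral-form Euler-Lagrange equation of
   int_{t0}^{t1} L(t, y(t), y'(t)) dt when H = d_3 L and G = - d_2 L. *)
Definition is_Euler_Lagrange (t0 t1 : R) (L H G : R -> R -> R -> R) : Prop :=
  C2_slab t0 t1 L /\
  forall t y v, cc t0 t1 t ->
    H t y v = pd3 L t y v /\ G t y v = - pd2 L t y v.

Definition continuous_pd23_along_curves (t0 t1 : R) (F : R -> R -> R -> R) : Prop :=
  forall y y' : R -> R, C2_curve t0 t1 y y' ->
    continuous_on (cc t0 t1) (along (pd2 F) y y') /\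
    continuous_on (cc t0 t1) (along (pd3 F) y y').

Definition variation_assumptions (t0 t1 : R) (H G : R -> R -> R -> R) : Prop :=
  ex_pd23 t0 t1 H /\ ex_pd23 t0 t1 G /\
  (forall t y v, cc t0 t1 t -> pd3 H t y v <> 0) /\
  continuous_pd23_along_curves t0 t1 H /\
  continuous_pd23_along_curves t0 t1 G.

(* Left-hand side of the equation of variation: its coefficients are functions of
   t taken along the curve u, and w is the function to which the resulting linear
   expression is applied; the equation in its usual notation is the case w = u. *)
Definition variation_lhs (t0 : R) (H G : R -> R -> R -> R)
    (u u' w w' : R -> R) (t : R) : R :=
  along (pd2 H) u u' t * w t + along (pd3 H) u u' t * w' t
  + RInt (fun s => along (pd2 G) u u' s * w s + along (pd3 G) u u' s * w' s) t0 t.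

Definition selfadjoint_lhs (t0 : R) (p q w w' : R -> R) (t : R) : R :=
  p t * w' t + RInt (fun s => q s * w s) t0 t.

(* The equation E = 0 has the form p w' + int q w = const: the coefficients p, q do
   not depend on w, and E differs from the self-adjoint expression by a quantity
   independent of t (it may depend on w, like the boundary term at t0 of an
   integration by parts).  An identity of expressions is required, not merely that
   each solution satisfies some equation of this form: for a single C^2 function
   without double zeros suitable p and q always exist, whatever E is. *)
Definition variation_self_adjoint (t0 t1 : R) (H G : R -> R -> R -> R)
    (u u' : R -> R) : Prop :=
  exists p q : R -> R,
    continuous_on (cc t0 t1) p /\ continuous_on (cc t0 t1) q /\
    (forall t, cc t0 t1 t -> p t <> 0) /\
    forall w w' : R -> R, C2_curve t0 t1 w w' ->
      exists c : R, forall t, cc t0 t1 t ->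
        variation_lhs t0 H G u u' w w' t = selfadjoint_lhs t0 p q w w' t - c.

(* Main.v *)
(** The Euler-Lagrange hypothesis [H = d_3 L], [G = - d_2 L] and Schwarz's theorem give
    [d_3 G = - d_2 H].  Writing [g] for [d_3 G] along [u], the terms [- g w] and
    [int g w'] of the equation of variation combine by integration by parts, since
    [g w' = (g w)' - g' w].  There remain [p = d_3 H], [q = d_2 G - g'] along [u] and the
    boundary term [c = g(t0) w(t0)]. *)
Require Import Defs.
From Stdlib Require Import Reals Lra.
From Coquelicot Require Import Coquelicot.
Open Scope R_scope.

Lemma continuous_on_plus {T : UniformSpace} (D : T -> Prop) (f g : T -> R) :
  continuous_on D f -> continuous_on D g -> continuous_on D (fun x => f x + g x).
Proof.
intros Hf Hg x Hx.
exact (filterlim_comp_2 _ _ _ (Hf x Hx) (Hg x Hx) (filterlim_plus (f x) (g x))).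
Qed.

Lemma continuous_on_mult {T : UniformSpace} (D : T -> Prop) (f g : T -> R) :
  continuous_on D f -> continuous_on D g -> continuous_on D (fun x => f x * g x).
Proof.
intros Hf Hg x Hx.
exact (filterlim_comp_2 _ _ _ (Hf x Hx) (Hg x Hx) (filterlim_mult (f x) (g x))).
Qed.

Lemma continuous_on_opp {T : UniformSpace} (D : T -> Prop) (f : T -> R) :
  continuous_on D f -> continuous_on D (fun x => - f x).
Proof.
intros Hf x Hx.
exact (filterlim_comp _ _ _ _ _ _ _ _ (Hf x Hx) (filterlim_opp (f x))).
Qed.

Lemma D_in_continuous_on (D : R -> Prop) (f f' : R -> R) :
  (forall x, D x -> D_in f f' D x) -> continuous_on D f.
Proof.
intros Hd x Hx.
apply filterlim_locally; intros eps.
destruct (cont_deriv _ _ _ _ (Hd x Hx) eps (cond_pos eps)) as [d [Hd0 Hd1]].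
exists (mkposreal d Hd0); intros z Hz HDz.
(* The limit in [D_in] leaves out the point [x] itself, whereas [continuous_on] includes it. *)
destruct (Req_dec z x) as [-> | Hne].
- apply ball_center.
- apply (Hd1 z).
  split; [split; [exact HDz | congruence] | exact Hz].
Qed.

Lemma D_in_is_derive (a b : R) (f f' : R -> R) (x : R) :
  a < x < b -> D_in f f' (cc a b) x -> is_derive f x (f' x).
Proof.
intros Hx Hd.
apply is_derive_Reals; intros eps Heps.
destruct (Hd eps Heps) as [d [Hd0 Hd1]].
(* This radius keeps [x + h] inside the interval, where the relative difference quotient is the
   ordinary one. *)
assert (Hm : 0 < Rmin d (Rmin (x - a) (b - x))) by
  (repeat apply Rmin_glb_lt; lra).
exists (mkposreal _ Hm); intros h Hh0 Hh; simpl in Hh.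
assert (Hhd := Rlt_le_trans _ _ _ Hh (Rmin_l _ _)).
assert (Hha := Rlt_le_trans _ _ _ Hh (Rmin_r _ _)).
assert (Hhb := Rlt_le_trans _ _ _ Hha (Rmin_r _ _)).
apply Rlt_le_trans with (2 := Rmin_l _ _) in Hha.
apply Rabs_def2 in Hha; apply Rabs_def2 in Hhb.
specialize (Hd1 (x + h)); simpl in Hd1; unfold Rdist in Hd1.
replace (x + h - x) with h in Hd1 by ring.
apply Hd1.
repeat split; try lra; unfold cc; lra.
Qed.

(** The nearest-point projection onto [[a,b]]. Composing with it extends a function continuous on
    [[a,b]] to one continuous on the whole line, to which results about two-sided limits apply. *)
Definition clamp (a b x : R) : R := Rmax a (Rmin b x).

Lemma clamp_cc (a b x : R) : a <= b -> cc a b (clamp a b x).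
Proof.
unfold cc, clamp; intros Hab.
split; [apply Rmax_l | apply Rmax_lub; [exact Hab | apply Rmin_l]].
Qed.

Lemma clamp_id (a b x : R) : cc a b x -> clamp a b x = x.
Proof.
intros [Ha Hb]; unfold clamp.
now rewrite Rmin_right, Rmax_right.
Qed.

Lemma clamp_lipschitz (a b x y : R) : Rabs (clamp a b y - clamp a b x) <= Rabs (y - x).
Proof.
unfold clamp, Rmax, Rmin.
repeat destruct Rle_dec; split_Rabs; lra.
Qed.

Lemma continuous_clamp {V : UniformSpace} (a b : R) (f : R -> V) :
  a <= b -> continuous_on (cc a b) f ->
  forall x, continuous (fun s => f (clamp a b s)) x.
Proof.
intros Hab Hf x P HP.
destruct (Hf _ (clamp_cc a b x Hab) P HP) as [d Hd].
exists d; intros z Hz.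
apply Hd; [| now apply clamp_cc].
exact (Rle_lt_trans _ _ _ (clamp_lipschitz a b x z) Hz).
Qed.

Lemma ex_RInt_cc (a b t : R) (f : R -> R) :
  cc a b t -> continuous_on (cc a b) f -> ex_RInt f a t.
Proof.
intros [Ha Hb] Hf.
apply ex_RInt_ext with (fun s => f (clamp a b s)).
- intros x; rewrite Rmin_left, Rmax_right by exact Ha; intros Hx.
  rewrite clamp_id; [reflexivity | unfold cc; lra].
- apply (@ex_RInt_continuous R_CompleteNormedModule); intros z _.
  apply (continuous_clamp a b f); [lra | exact Hf].
Qed.

(** The fundamental theorem of calculus for derivatives that are one-sided at the end points. The
    difference of [f] and a primitive of [f'] has zero derivative inside the interval and is
    continuous up to its ends, so the mean value theorem makes it constant. *)
Lemma is_RInt_C1_curve (a b t : R) (f f' : R -> R) :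
  C1_curve a b f f' -> cc a b t -> is_RInt f' a t (f t - f a).
Proof.
intros [Hd Hc] Ht.
assert (Ht' := Ht); destruct Ht' as [Ha Hb].
assert (Hab : a <= b) by lra.
pose (phi := fun s => f' (clamp a b s)).
assert (Hphi : forall x, continuous phi x) by now apply continuous_clamp.
assert (HPhi : forall x, is_derive (fun y => RInt phi a y) x (phi x)).
{ intros x; apply is_derive_RInt with a; [| apply Hphi].
  apply filter_forall; intros y.
  apply (@RInt_correct R_CompleteNormedModule).
  apply (@ex_RInt_continuous R_CompleteNormedModule); intros; apply Hphi. }
assert (Hf : forall x, continuous (fun s => f (clamp a b s)) x).
{ apply continuous_clamp; [exact Hab | now apply D_in_continuous_on with f']. }
(* Clamping makes [f] two-sidedly continuous at the end points, as [MVT_gen] requires. *)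
destruct (MVT_gen (fun s => f (clamp a b s) - RInt phi a s) a t (fun _ => 0))
  as [c [_ Hc0]].
- intros x; rewrite Rmin_left, Rmax_right by exact Ha; intros Hx.
  assert (Hxc : cc a b x) by (unfold cc; lra).
  replace 0 with (f' x - phi x) by (unfold phi; rewrite clamp_id by exact Hxc; ring).
  apply @is_derive_minus; [| apply HPhi].
  (* Clamping changes nothing near an interior point. *)
  apply is_derive_ext_loc with f.
  + apply filter_imp with (fun s => a < s < b).
    * intros s Hs; rewrite clamp_id; [reflexivity | unfold cc; lra].
    * apply filter_and; [apply (open_gt a) | apply (open_lt b)]; lra.
  + apply (D_in_is_derive a b); [lra | now apply Hd].
- intros x _.
  apply continuity_pt_filterlim.
  apply (continuous_minus (fun s => f (clamp a b s)) (fun s => RInt phi a s) x);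
    [apply Hf |].
  apply ex_derive_continuous; eexists; apply HPhi.
(* The integral from [a] to [a] vanishes, so the constant difference is [f a]. *)
- rewrite RInt_point, !clamp_id in Hc0 by (unfold cc; lra).
  change (zero : R_NormedModule) with 0 in Hc0.
  replace (f t - f a) with (RInt phi a t) by lra.
  apply is_RInt_ext with phi.
  + intros x; rewrite Rmin_left, Rmax_right by exact Ha; intros Hx.
    unfold phi; rewrite clamp_id; [reflexivity | unfold cc; lra].
  + apply (@RInt_correct R_CompleteNormedModule).
    apply (@ex_RInt_continuous R_CompleteNormedModule); intros; apply Hphi.
Qed.

Lemma C1_curve_mult (a b : R) (f f' g g' : R -> R) :
  C1_curve a b f f' -> C1_curve a b g g' ->
  C1_curve a b (fun t => f t * g t) (fun t => f' t * g t + f t * g' t).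
Proof.
intros [Hf Hf'] [Hg Hg']; split.
- intros t Ht; apply Dmult; [now apply Hf | now apply Hg].
- apply continuous_on_plus; apply continuous_on_mult; try assumption;
    eapply D_in_continuous_on; eassumption.
Qed.

(** With [t] frozen, no nearby point leaves the slab, so relative continuity becomes the ordinary
    continuity in [(y, v)] that Schwarz's theorem asks for. *)
Lemma slab_continuous_2d (a b : R) (F : R -> R -> R -> R) (t y v : R) :
  slab_continuous a b F -> cc a b t -> continuity_2d_pt (F t) y v.
Proof.
intros HF Ht eps.
destruct (proj1 (filterlim_locally _ _) (HF (t, y, v) Ht) eps) as [d Hd].
exists d; intros y' v' Hy Hv.
apply (Hd (t, y', v')); [| exact Ht].
split; [split |]; [apply ball_center | exact Hy | exact Hv].
Qed.

Lemma pd2_pd3_comm (a b : R) (L : R -> R -> R -> R) (t y v : R) :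
  C2_slab a b L -> cc a b t -> pd2 (pd3 L) t y v = pd3 (pd2 L) t y v.
Proof.
intros (_ & HL & (_ & H2 & _ & H23) & (_ & H3 & H32 & _)) Ht.
apply (Schwarz (L t)).
(* Any radius would do: the derivatives exist on the whole plane of fixed [t]. *)
- exists (mkposreal 1 Rlt_0_1); intros y' v' _ _.
  split; [| split; [| split]].
  + exact (proj1 (HL t y' v' Ht)).
  + exact (proj2 (HL t y' v' Ht)).
  + exact (proj1 (H3 t y' v' Ht)).
  + exact (proj2 (H2 t y' v' Ht)).
- exact (slab_continuous_2d a b (pd2 (pd3 L)) t y v H32 Ht).
- exact (slab_continuous_2d a b (pd3 (pd2 L)) t y v H23 Ht).
Qed.

Lemma Euler_Lagrange_pd_comm (a b : R) (L H G : R -> R -> R -> R) (t y v : R) :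
  is_Euler_Lagrange a b L H G -> cc a b t -> pd2 H t y v = - pd3 G t y v.
Proof.
intros [HL HE] Ht.
transitivity (pd2 (pd3 L) t y v).
(* The identities for [H] and [G] hold for all [y] and [v] at the given [t], so they may be
   differentiated in these arguments. *)
{ apply Derive_ext; intros z; now apply HE. }
rewrite (pd2_pd3_comm a b) by assumption.
transitivity (- pd3 (fun t y v => - pd2 L t y v) t y v).
{ unfold pd3; rewrite Derive_opp, Ropp_involutive; reflexivity. }
f_equal; apply Derive_ext; intros z; symmetry; now apply HE.
Qed.

Theorem corollary3p9 (t0 t1 : R) (ht : t0 < t1)
    (H G : R -> R -> R -> R) (hHG : variation_assumptions t0 t1 H G)
    (L : R -> R -> R -> R) (hEL : is_Euler_Lagrange t0 t1 L H G)
    (u u' : R -> R) (hu : C2_curve t0 t1 u u')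
    (hreg : exists g' : R -> R, C1_curve t0 t1 (along (pd3 G) u u') g') :
  variation_self_adjoint t0 t1 H G u u'.
Proof.
(* That [L] is C^2 gives continuity of d_3 G along [u]; [hreg] supplies the continuous derivative
   used in the integration by parts. *)
destruct hreg as [g' Hg].
destruct hHG as (_ & _ & Hnz & HcH & HcG).
destruct (HcH u u' hu) as [_ Hp].
destruct (HcG u u' hu) as [Hr _].
exists (along (pd3 H) u u'), (fun s => along (pd2 G) u u' s - g' s).
assert (Hq : continuous_on (cc t0 t1) (fun s => along (pd2 G) u u' s - g' s)).
{ apply continuous_on_plus; [exact Hr | apply continuous_on_opp, Hg]. }
split; [exact Hp |].
split; [exact Hq |].
split; [intros t Ht; now apply Hnz |].
intros w w' [Hw _].
set (g := along (pd3 G) u u') in *.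
exists (g t0 * w t0); intros t Ht.
assert (Hqw : ex_RInt (fun s => (along (pd2 G) u u' s - g' s) * w s) t0 t).
{ apply (ex_RInt_cc t0 t1); [exact Ht |].
  apply continuous_on_mult; [exact Hq |].
  apply D_in_continuous_on with w'; apply Hw. }
assert (Hgw := is_RInt_C1_curve t0 t1 t _ _ (C1_curve_mult _ _ _ _ _ _ Hg Hw) Ht).
assert (HI : RInt (fun s => along (pd2 G) u u' s * w s + g s * w' s) t0 t
  = RInt (fun s => (along (pd2 G) u u' s - g' s) * w s) t0 t
    + (g t * w t - g t0 * w t0)).
{ rewrite <- (is_RInt_unique _ _ _ _ Hgw).
  etransitivity; [| apply (RInt_plus (V := R_CompleteNormedModule));
    [exact Hqw | eexists; exact Hgw]].
  apply RInt_ext; intros s _; unfold plus; simpl; ring. }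
unfold variation_lhs, selfadjoint_lhs.
fold g; rewrite HI.
replace (along (pd2 H) u u' t) with (- g t).
- ring.
- symmetry; exact (Euler_Lagrange_pd_comm t0 t1 L H G t _ _ hEL Ht).
Qed.
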